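(* Let $\mathfrak{B}$ be a bornology on a metric space $X$ with a closed base. Let $\mathcal{I}_1,\mathcal{I}_2,\mathcal{J}_1,\mathcal{J}_2$ be ideals on $\omega$ with $\mathcal{I}_1\leq_{K}\mathcal{I}_2$ and $\mathcal{J}_1\leq_{KB}\mathcal{J}_2$. The following statements hold. (1) If $X$ satisfies $\mathrm{S}_1(\mathcal{I}_2\text{-}\Gamma_{\mathfrak{B}^s},\mathcal{O}_{\mathfrak{B}^s})$, then $X$ satisfies $\mathrm{S}_1(\mathcal{I}_1\text{-}\Gamma_{\mathfrak{B}^s},\mathcal{O}_{\mathfrak{B}^s})$. (2) If $X$ satisfies $\mathrm{S}_1(\mathcal{O}_{\mathfrak{B}^s},\mathcal{J}_1\text{-}\Gamma_{\mathfrak{B}^s})$, then $X$ satisfies $\mathrm{S}_1(\mathcal{O}_{\mathfrak{B}^s},\mathcal{J}_2\text{-}\Gamma_{\mathfrak{B}^s})$.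
   Context: $(X,d)$ is an infinite metric space; $\omega$ is the set of natural numbers. A bornology $\mathfrak{B}$ on $X$ is a family of subsets of $X$ that is closed under subsets and finite unions and covers $X$. A base of $\mathfrak{B}$ is a subfamily $\mathfrak{B}_0\subseteq\mathfrak{B}$ such that every $B\in\mathfrak{B}$ is contained in some $B_0\in\mathfrak{B}_0$; it is a closed base if its members are closed. For $B\in\mathfrak{B}$, $\delta>0$: $B^\delta=\bigcup_{x\in B}\{y\in X:d(x,y)<\delta\}$. An ideal on $\omega$ is a family $\mathcal{I}\subseteq\mathcal{P}(\omega)$ closed under subsets and finite unions, containing all finite sets, with $\omega\notin\mathcal{I}$. For ideals $\mathcal{I},\mathcal{J}$: $\mathcal{I}\leq_{K}\mathcal{J}$ means there is a function $\phi:\omega\to\omega$ with $\phi^{-1}(A)\in\mathcal{J}$ for all $A\in\mathcal{I}$; $\mathcal{I}\leq_{KB}\mathcal{J}$ means there is such a $\phi$ that is finite-to-one. Covers of $X$ never contain $X$ as an element. A cover $\mathcal{U}$ of $X$ by open sets is an open $\mathfrak{B}^s$-cover if for each $B\in\mathfrak{B}$ there are $U\in\mathcal{U}$ and $\delta>0$ with $B^\delta\subseteq U$; $\mathcal{O}_{\mathfrak{B}^s}$ is the class of these. A countable open cover $\{U_n:n\in\omega\}$ (with its enumeration) is an $\mathcal{I}$-$\gamma_{\mathfrak{B}^s}$-cover if for each $B\in\mathfrak{B}$ there is a sequence $\{\delta_n\}$ of positive reals with $\{n\in\omega:B^{\delta_n}\nsubseteq U_n\}\in\mathcal{I}$; $\mathcal{I}\text{-}\Gamma_{\mathfrak{B}^s}$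 is the class of these. $\mathrm{S}_1(\mathcal{A},\mathcal{B})$: for every sequence $\{A_n:n\in\omega\}$ of elements of $\mathcal{A}$ there are $a_n\in A_n$ ($n\in\omega$) such that $\{a_n:n\in\omega\}\in\mathcal{B}$ (for enumerated covers, with the enumeration $n\mapsto a_n$). *)

(* Defs.v *)
From mathcomp Require Import all_boot all_order all_algebra.
From mathcomp Require Import all_classical all_reals topology.

Set Implicit Arguments.
Unset Strict Implicit.
Unset Printing Implicit Defensive.

Local Open Scope classical_set_scope.
Local Open Scope ring_scope.

Record is_ideal (I : set (set nat)) : Prop := IsIdeal {
  ideal_subset : forall A B, A `<=` B -> I B -> I A ;
  ideal_setU : forall A B, I A -> I B -> I (A `|` B) ;
  ideal_finite : forall A, finite_set A -> I A ;
  ideal_proper : ~ I setT }.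

Definition finite_to_one (phi : nat -> nat) : Prop :=
  forall m, finite_set (phi @^-1` [set m]).

Definition katetov_le (I J : set (set nat)) : Prop :=
  exists phi : nat -> nat, forall A, I A -> J (phi @^-1` A).

Definition katetov_blass_le (I J : set (set nat)) : Prop :=
  exists2 phi : nat -> nat,
    finite_to_one phi & forall A, I A -> J (phi @^-1` A).

Record is_bornology (T : Type) (B : set (set T)) : Prop := IsBornology {
  bornology_subset : forall A C, A `<=` C -> B C -> B A ;
  bornology_setU : forall A C, B A -> B C -> B (A `|` C) ;
  bornology_cover : \bigcup_(A in B) A = setT }.

Definition is_base (T : Type) (B B0 : set (set T)) : Prop :=
  B0 `<=` B /\ forall A, B A -> exists2 A0, B0 A0 & A `<=` A0.

Definition has_closed_base (T : topologicalType) (B : set (set T)) : Prop :=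
  exists B0, is_base B B0 /\ forall A, B0 A -> closed A.

(* Covers of X are not allowed to contain X itself. *)
Definition is_cover (T : Type) (U : set (set T)) : Prop :=
  \bigcup_(A in U) A = setT /\ ~ U setT.

Definition enlargement (R : realType) (X : metricType R)
    (A : set X) (delta : R) : set X :=
  \bigcup_(x in A) [set y | mdist x y < delta].

Section bornological_covers.
Context {R : realType} {X : metricType R}.
Implicit Types B : set (set X).

Definition open_Bs_cover B : set (set (set X)) :=
  [set U | [/\ is_cover U, (forall V, U V -> open V) &
    forall A, B A -> exists V, U V /\
      exists2 delta : R, 0 < delta & enlargement A delta `<=` V]].

(* Membership depends on the enumeration, which may repeat elements: an element
   of this class is a sequence, not the family it enumerates. *)
Definition ideal_gamma_Bs_cover (I : set (set nat)) B : set (nat -> set X) :=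
  [set U | [/\ is_cover (range U), (forall n, open (U n)) &
    forall A, B A -> exists delta : nat -> R, (forall n, 0 < delta n) /\
      I [set n | ~ (enlargement A (delta n) `<=` U n)]]].

End bornological_covers.

(* The selection principle S_1, for a class [A] of families and a class [C] of
   sequences. A class of sequences is used as source through the families it
   enumerates ([enumerated_families]), and a class of families is used as
   target through the enumerations of its members ([enumerations]). *)
Definition S1 (Y : Type) (A : set (set Y)) (C : set (nat -> Y)) : Prop :=
  forall F : nat -> set Y, (forall n, A (F n)) ->
    exists a : nat -> Y, (forall n, F n (a n)) /\ C a.

Definition enumerated_families (Y : Type) (C : set (nat -> Y)) : set (set Y) :=
  [set range u | u in C].

Definition enumerations (Y : Type) (A : set (set Y)) : set (nat -> Y) :=
  [set u | A (range u)].

(* Main.v *)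
Require Import Defs.
From mathcomp Require Import all_boot all_order all_algebra.
From mathcomp Require Import all_classical all_reals topology.

Set Implicit Arguments.
Unset Strict Implicit.
Unset Printing Implicit Defensive.

Import Order.TTheory Num.Theory.

(** The Katetov map [phi] reindexes covers.  If [u] is an
    [I1]-gamma cover, then along [u \o phi] the indices that are bad for a
    bounded set form the [phi]-preimage of those bad along [u], hence a set of
    [I2] ([gamma_cover_reindex]); since [u \o phi] only enumerates members of
    [range u], a selection from the reindexed covers is a selection from the
    original ones.  This gives the first implication.

    For the second, the selection must be pulled back: a single set chosen at
    stage [m] has to serve every stage [k] with [phi k = m].  Because [phi] is
    finite-to-one these [k] are bounded by some [h m], so stage [m] can be fed
    the common refinement of the open covers of index at most [h m], which is
    again an open cover of the same class ([common_refinement_cover]).  A set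
    [a m] selected there lies inside a member of each relevant cover; enlarging
    [a (phi k)] to a member [b k] of the [k]-th cover can only make bad indices
    good, so [b] is a [J2]-gamma cover ([gamma_cover_reindex] again). *)

Local Open Scope classical_set_scope.
Local Open Scope ring_scope.

Section Reindexing.
Context {R : realType} {X : metricType R}.
Implicit Types (B : set (set X)) (A : set X).

Lemma enlargement_id A (delta : R) : 0 < delta -> A `<=` enlargement A delta.
Proof. by move=> d0 x Ax; exists x => //=; rewrite mdistxx. Qed.

Lemma enlargement_mono A (d e : R) :
  d <= e -> enlargement A d `<=` enlargement A e.
Proof. by move=> de y [x Ax /= xy]; exists x => //=; exact: lt_le_trans de. Qed.

(** Every point lies in some bounded set, so swallowing bounded sets is enough
    to cover the space. *)
Lemma bornology_swallowed_cover B (U : set (set X)) : is_bornology B ->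
  (forall A, B A -> exists2 V, U V & A `<=` V) -> \bigcup_(V in U) V = setT.
Proof.
move=> hB UB; apply/seteqP; split=> // x _.
have : (\bigcup_(A in B) A) x by rewrite (bornology_cover hB).
by move=> [A /UB[V UV AV] /AV Vx]; exists V.
Qed.

(** Badness of an index for a bounded set pulls back along the Katetov map
    with the same radii, and enlarging the members only removes bad indices.
    The new sequence still covers because [J], being proper, leaves at least
    one good index for every bounded set. *)
Lemma gamma_cover_reindex (I J : set (set nat)) B (phi : nat -> nat)
    (u v : nat -> set X) : is_bornology B -> is_ideal J ->
  (forall E, I E -> J (phi @^-1` E)) ->
  ideal_gamma_Bs_cover I B u ->
  (forall k, u (phi k) `<=` v k) ->
  (forall k, open (v k)) -> (forall k, v k <> setT) ->
  ideal_gamma_Bs_cover J B v.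
Proof.
move=> hB hJ hphi [_ _ ugamma] uv vopen vneq.
have vgamma A : B A -> exists delta : nat -> R, (forall n, 0 < delta n) /\
    J [set n | ~ (enlargement A (delta n) `<=` v n)].
  move=> /ugamma[delta [delta0 Idelta]]; exists (delta \o phi).
  split=> [n|]; first exact: delta0.
  apply: ideal_subset (hphi _ Idelta) => // k /= nv AU; apply: nv.
  exact: subset_trans (uv k).
split=> //; split; last by move=> [k _ /vneq].
apply: (bornology_swallowed_cover hB) => A /vgamma[delta [delta0 Jdelta]].
have [k Ak] : exists k, enlargement A (delta k) `<=` v k.
  apply: contrapT => nogood; apply: (ideal_proper hJ).
  apply: ideal_subset Jdelta => // k _ /= Ak.
  by apply: nogood; exists k.
by exists (v k); [exists k | apply: subset_trans Ak; exact: enlargement_id].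
Qed.

End Reindexing.

Section CommonRefinement.
Context {R : realType} {X : metricType R}.
Variables (B : set (set X)) (F : nat -> set (set X)).

(** All open sets subordinate to the first covers are taken, rather than just
    the intersections of their members; this is downward closed among open
    sets, and it omits the whole space as soon as [F 0] does. *)
Definition common_refinement (n : nat) : set (set X) :=
  [set W | open W /\ forall k, (k <= n)%N -> exists2 V, F k V & W `<=` V].

Hypothesis hF : forall n, open_Bs_cover B (F n).

Lemma open_Bs_cover_neqT n V : F n V -> V <> setT.
Proof. by have [[_ FT] _ _] := hF n => FV VT; apply: FT; rewrite -VT. Qed.

(** Intersecting finitely many sets that contain uniform neighbourhoods of [A]
    keeps one, with the least radius. *)
Lemma common_refinement_enlargement n A : B A ->
  exists2 W, common_refinement n W &
    exists2 delta : R, 0 < delta & enlargement A delta `<=` W.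
Proof.
move=> BA; elim: n => [|n [W [Wo WF] [d d0 AW]]].
  have [_ Fo /(_ A BA)[V [FV AV]]] := hF 0%N.
  exists V => //; split; first exact: Fo.
  by move=> k; rewrite leqn0 => /eqP->; exists V.
have [_ Fo /(_ A BA)[V [FV [e e0 AV]]]] := hF n.+1.
exists (W `&` V).
  split; first by apply: openI => //; exact: Fo.
  move=> k; rewrite leq_eqVlt => /predU1P[->|/WF[V' FV' WV']].
    by exists V => //; exact: subIsetr.
  by exists V' => //; apply: subset_trans WV'; exact: subIsetl.
exists (Order.min d e); first by rewrite lt_min d0.
rewrite subsetI; split.
  by apply: subset_trans AW; apply: enlargement_mono; rewrite ge_min lexx.
by apply: subset_trans AV; apply: enlargement_mono; rewrite ge_min lexx orbT.
Qed.

Lemma common_refinement_cover n : is_bornology B ->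
  open_Bs_cover B (common_refinement n).
Proof.
move=> hB; split=> [|V []//|A /(common_refinement_enlargement n)[W nW AW]];
  last by exists W.
split.
  apply: (bornology_swallowed_cover hB) => A.
  move=> /(common_refinement_enlargement n)[W nW [d d0 AW]].
  by exists W => //; apply: subset_trans AW; exact: enlargement_id.
move=> [_ /(_ _ (leq0n n))[V F0V TV]].
by apply: (open_Bs_cover_neqT F0V); apply/seteqP.
Qed.

End CommonRefinement.

(** Bounding the fibres, instead of listing them, lets every stage refine a
    nonempty initial segment of the covers, even where a fibre is empty. *)
Lemma finite_to_one_fiber_bound (phi : nat -> nat) : finite_to_one phi ->
  exists h : nat -> nat, forall k, (k <= h (phi k))%N.
Proof.
move=> fphi.
have /choice[h hP] : forall m, exists N, forall k, phi k = m -> (k <= N)%N.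
  move=> m; have /finite_seqP[s sE] := fphi m.
  exists (\max_(i <- s) i)%N => k km.
  have : (phi @^-1` [set m]) k by [].
  by rewrite sE /= => ks; exact: (@leq_bigmax_seq _ s predT id).
by exists h => k; exact: hP.
Qed.

Section SelectionTransfer.
Context {R : realType} {X : metricType R}.
Context (B : set (set X)) (hB : is_bornology B).

Lemma S1_gamma_source_katetov (C : set (nat -> set X)) (I J : set (set nat)) :
  is_ideal J -> katetov_le I J ->
  S1 (enumerated_families (ideal_gamma_Bs_cover J B)) C ->
  S1 (enumerated_families (ideal_gamma_Bs_cover I B)) C.
Proof.
move=> hJ [phi hphi] selJ F hF.
have /choice[u uP] : forall n, exists u,
    ideal_gamma_Bs_cover I B u /\ range u = F n.
  by move=> n; have [u] := hF n; exists u.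
have [n|a [aF Ca]] := selJ (fun n => range (u n \o phi)).
  have [ugamma _] := uP n.
  exists (u n \o phi) => //.
  have [[_ uT] uo _] := ugamma.
  apply: (gamma_cover_reindex hB hJ hphi ugamma) => k.
  - exact: subset_refl.
  - exact: uo.
  - by move=> uk; apply: uT; exists (phi k).
exists a; split=> // n.
have [_ <-] := uP n.
by have [k _ <-] := aF n; exists (phi k).
Qed.

Lemma S1_gamma_target_katetov_blass (I J : set (set nat)) :
  is_ideal J -> katetov_blass_le I J ->
  S1 (open_Bs_cover B) (ideal_gamma_Bs_cover I B) ->
  S1 (open_Bs_cover B) (ideal_gamma_Bs_cover J B).
Proof.
move=> hJ [phi /finite_to_one_fiber_bound[h hP] hphi] selI F hF.
have [m|a [aF agamma]] := selI (fun m => common_refinement F (h m)).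
  exact: common_refinement_cover.
have /choice[b bP] : forall k, exists V, F k V /\ a (phi k) `<=` V.
  by move=> k; have [_ /(_ k (hP k))[V]] := aF (phi k); exists V.
exists b; split=> [k|]; first by have [] := bP k.
apply: (gamma_cover_reindex hB hJ hphi agamma) => k; have [Fb ab] := bP k => //.
  by have [_ + _] := hF k; exact.
exact: open_Bs_cover_neqT hF _ _ Fb.
Qed.

End SelectionTransfer.

Theorem theorem3p7 (R : realType) (X : metricType R)
    (Xinf : infinite_set [set: X])
    (B : set (set X)) (hB : is_bornology B) (hB0 : has_closed_base B)
    (I1 I2 J1 J2 : set (set nat))
    (hI1 : is_ideal I1) (hI2 : is_ideal I2)
    (hJ1 : is_ideal J1) (hJ2 : is_ideal J2)
    (hI : katetov_le I1 I2) (hJ : katetov_blass_le J1 J2) :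
  (S1 (enumerated_families (ideal_gamma_Bs_cover I2 B))
      (enumerations (open_Bs_cover B)) ->
   S1 (enumerated_families (ideal_gamma_Bs_cover I1 B))
      (enumerations (open_Bs_cover B)))
  /\
  (S1 (open_Bs_cover B) (ideal_gamma_Bs_cover J1 B) ->
   S1 (open_Bs_cover B) (ideal_gamma_Bs_cover J2 B)).
Proof.
split.
  exact: S1_gamma_source_katetov.
exact: S1_gamma_target_katetov_blass.
Qed.
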